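(* Let $J=\{1,\dots,n\}$, let $x_j\in\mathbb{R}^m$, $y_j\in\mathbb{R}^s$ ($j\in J$) be vectors with strictly positive components, and let $o\in J$. Assume that $DMU_o=(x_o,y_o)$ is $FDH_V$-efficient and that G-IRS (global increasing returns to scale) prevails at it. Define, for $j\in J$, $$\alpha_{jo}:=\max_{1\le i\le m}\frac{x_{ij}}{x_{io}},\qquad \beta_{jo}:=\min_{1\le r\le s}\frac{y_{rj}}{y_{ro}},\qquad \Pi:=\{j\in J:\ \alpha_{jo}>1\}.$$ Then: (i) $\Pi\neq\emptyset$. (ii) $\displaystyle \sigma_o^+=\max_{j\in\Pi}\frac{\beta_{jo}-1}{\alpha_{jo}-1}$, where $\sigma_o^+$ is the maximum incremental ratio of $DMU_o$.
   Context: There are $n$ decision making units $DMU_j=(x_j,y_j)$, $j\in J=\{1,\dots,n\}$, with input vectors $x_j=(x_{1j},\dots,x_{mj})^t$ and output vectors $y_j=(y_{1j},\dots,y_{sj})^t$, all entries strictly positive. Vector inequalities are componentwise. For a set $\Delta$ of scaling factors let $$T^{FDH_\Delta}=\Big\{(x,y):\ \exists\,\mu\in\{0,1\}^n,\ \delta\in\Delta,\ \sum_{j}\mu_j=1,\ \lambda_j=\delta\mu_j\ (j\in J),\ \sum_j\lambda_jx_j\le x,\ \sum_j\lambda_jy_j\ge y\ge 0\Big\},$$ with $\Delta=\{1\}$ for $FDH_V$, $\Delta=\{\delta\ge0\}$ for $FDH_C$, $\Delta=\{0\le\delta\le1\}$ for $FDH_{NI}$, and $\Delta=\{\delta\ge1\}$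 for $FDH_{ND}$. $DMU_o$ is $FDH_V$-efficient if there is no $(x,y)\in T^{FDH_V}$ with $x\le x_o$, $y\ge y_o$, $(x,y)\ne(x_o,y_o)$. The input-oriented radial efficiency measure $\theta_o^{\Delta}$, for each of $FDH_C$, $FDH_{NI}$, $FDH_{ND}$ with its corresponding set $\Delta$, is the minimum of $\theta$ subject to $\sum_j\lambda_jx_j\le\theta x_o$, $\sum_j\lambda_jy_j\ge y_o$, $\lambda_j=\delta\mu_j$, $\mu_j\in\{0,1\}$, $\sum_j\mu_j=1$, $\delta\in\Delta$. For an $FDH_V$-efficient $DMU_o$, G-IRS prevails at $DMU_o$ iff $\theta_o^{FDH_{ND}}>\theta_o^{FDH_C}=\theta_o^{FDH_{NI}}$. Response function: $\beta_o(\alpha):=\max\{\beta\in\mathbb{R}:\ (\alpha x_o,\beta y_o)\in T^{FDH_V}\}$, defined for those $\alpha$ for which some such $\beta$ exists. Its domain is $[\underline{\alpha},+\infty)$ for some $\underline{\alpha}\le1$. Maximum incremental ratio: $\displaystyle\sigma_o^+:=\max_{\alpha>1}\frac{\beta_o(\alpha)-1}{\alpha-1}$. *)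

(* Defs.v *)
From mathcomp Require Import all_boot all_order all_algebra.
From mathcomp Require Import all_classical all_reals.
Set Implicit Arguments.
Unset Strict Implicit.
Unset Printing Implicit Defensive.
Import Order.TTheory GRing.Theory Num.Theory.
Local Open Scope classical_set_scope.
Local Open Scope ring_scope.

Definition is_max (R : realType) (A : set R) (v : R) : Prop := A v /\ ubound A v.
Definition is_min (R : realType) (A : set R) (v : R) : Prop := A v /\ lbound A v.

Definition levec (R : realType) (k : nat) (u v : 'cV[R]_k) : Prop :=
  forall i, u i 0 <= v i 0.

(* The index range is nonempty, so no default value is involved: these are
   values of F that are largest (resp. smallest). *)
Definition max_ord (R : realType) (k : nat) (F : 'I_k.+1 -> R) : R :=
  F [arg max_(i > ord0) F i]%O.
Definition min_ord (R : realType) (k : nat) (F : 'I_k.+1 -> R) : R :=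
  F [arg min_(i < ord0) F i]%O.

Definition Delta_V (R : realType) : set R := [set 1].
Definition Delta_C (R : realType) : set R := [set d | 0 <= d].
Definition Delta_NI (R : realType) : set R := [set d | 0 <= d <= 1].
Definition Delta_ND (R : realType) : set R := [set d | 1 <= d].

Definition intensity (R : realType) (n : nat) (Delta : set R)
    (lambda : 'I_n -> R) : Prop :=
  exists (mu : 'I_n -> R) (delta : R),
    [/\ forall j, mu j = 0 \/ mu j = 1,
        \sum_j mu j = 1,
        Delta delta
      & forall j, lambda j = delta * mu j].

Definition FDH_tech (R : realType) (n m s : nat)
    (x : 'I_n -> 'cV[R]_m) (y : 'I_n -> 'cV[R]_s) (Delta : set R) :
    set ('cV[R]_m * 'cV[R]_s) :=
  [set p | exists lambda : 'I_n -> R,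
    [/\ intensity Delta lambda,
        levec (\sum_j lambda j *: x j) p.1,
        levec p.2 (\sum_j lambda j *: y j)
      & levec 0 p.2]].

Definition FDH_V_efficient (R : realType) (n m s : nat)
    (x : 'I_n -> 'cV[R]_m) (y : 'I_n -> 'cV[R]_s) (o : 'I_n) : Prop :=
  ~ exists p : 'cV[R]_m * 'cV[R]_s,
      [/\ FDH_tech x y (@Delta_V R) p, levec p.1 (x o), levec (y o) p.2
        & p <> (x o, y o)].

Definition is_radial_efficiency (R : realType) (n m s : nat)
    (x : 'I_n -> 'cV[R]_m) (y : 'I_n -> 'cV[R]_s) (o : 'I_n)
    (Delta : set R) (theta : R) : Prop :=
  is_min [set t | exists lambda : 'I_n -> R,
    [/\ intensity Delta lambda,
        levec (\sum_j lambda j *: x j) (t *: x o)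
      & levec (y o) (\sum_j lambda j *: y j)]] theta.

Definition G_IRS (R : realType) (n m s : nat)
    (x : 'I_n -> 'cV[R]_m) (y : 'I_n -> 'cV[R]_s) (o : 'I_n) : Prop :=
  exists theta_ND theta_C theta_NI : R,
    [/\ is_radial_efficiency x y o (@Delta_ND R) theta_ND,
        is_radial_efficiency x y o (@Delta_C R) theta_C,
        is_radial_efficiency x y o (@Delta_NI R) theta_NI,
        theta_C < theta_ND
      & theta_C = theta_NI].

(* Graph of the response function: [is_response x y o a b] says that it is
   defined at [a] with value [b]. *)
Definition is_response (R : realType) (n m s : nat)
    (x : 'I_n -> 'cV[R]_m) (y : 'I_n -> 'cV[R]_s) (o : 'I_n) (a b : R) : Prop :=
  is_max [set b' | FDH_tech x y (@Delta_V R) (a *: x o, b' *: y o)] b.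

Definition is_max_incremental_ratio (R : realType) (n m s : nat)
    (x : 'I_n -> 'cV[R]_m) (y : 'I_n -> 'cV[R]_s) (o : 'I_n) (sigma : R) : Prop :=
  is_max [set r | exists a b : R,
    [/\ 1 < a, is_response x y o a b & r = (b - 1) / (a - 1)]] sigma.

Definition alpha_ratio (R : realType) (n m : nat)
    (x : 'I_n -> 'cV[R]_m.+1) (o j : 'I_n) : R :=
  max_ord (fun i => x j i 0 / x o i 0).

Definition beta_ratio (R : realType) (n s : nat)
    (y : 'I_n -> 'cV[R]_s.+1) (o j : 'I_n) : R :=
  min_ord (fun r => y j r 0 / y o r 0).

Definition Pi_set (R : realType) (n m : nat)
    (x : 'I_n -> 'cV[R]_m.+1) (o : 'I_n) : set 'I_n :=
  [set j | 1 < alpha_ratio x o j].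

(* Main.v *)
Require Import Defs.
From mathcomp Require Import all_boot all_order all_algebra.
From mathcomp Require Import all_classical all_reals.
Set Implicit Arguments.
Unset Strict Implicit.
Unset Printing Implicit Defensive.
Import Order.TTheory GRing.Theory Num.Theory.
Local Open Scope classical_set_scope.
Local Open Scope ring_scope.

(** Since exactly one unit is active in an FDH technology, every object of the
    theorem depends on the data only through the pairs [(a_j, b_j)] made of
    [alpha_ratio x o j] and [beta_ratio y o j], where [(a_o, b_o) = (1, 1)]:
    - a radial factor [t] is feasible for [Delta] iff some [j] and some [d] in
      [Delta] satisfy [d * a_j <= t] and [1 <= d * b_j]
      ([radial_feasibleP]);
    - the response at [a] is the largest [b_j] among the [j] with [a_j <= a]
      ([response_domainP], [response_attained]);
    - efficiency of [o] forces [b_j <= 1] whenever [a_j <= 1]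
      ([efficient_beta_le1]).

    Under increasing returns the C and NI efficiencies agree and lie below the
    ND one.  A unit [j] that attains the NI efficiency does so with a scaling
    [d < 1], as [d = 1] would be feasible for ND.  Hence [b_j >= 1/d > 1], and
    efficiency gives [a_j > 1].  This proves that [Pi] is nonempty and contains a unit whose
    slope [(b_j - 1) / (a_j - 1)] is positive ([GIRS_witness]).

    The largest slope [sigma] over [Pi] is therefore positive.  If the response
    at [a > 1] is [b_j], then either [a_j <= 1] and the incremental ratio is
    nonpositive, or [1 < a_j <= a] and, as [b_j >= b_o = 1], replacing [a] by
    [a_j] can only increase the ratio; in both cases it is at most [sigma].
    Conversely, at [a = a_j] with [j] of largest slope, the response is at least
    [b_j], so that the incremental ratio reaches [sigma]. *)

(** * Reduction to a single active unit *)

(** The condition [P] is arbitrary so that the same reduction serves both the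
    technologies and the radial programs. *)
Lemma intensityP (R : realType) (n m s : nat) (x : 'I_n -> 'cV[R]_m)
    (y : 'I_n -> 'cV[R]_s) (Delta : set R)
    (P : 'cV[R]_m -> 'cV[R]_s -> Prop) :
  (exists lambda, intensity Delta lambda /\
     P (\sum_j lambda j *: x j) (\sum_j lambda j *: y j)) <->
  (exists j d, Delta d /\ P (d *: x j) (d *: y j)).
Proof.
have sumE k (z : 'I_n -> 'cV[R]_k) (lambda : 'I_n -> R) j d :
    lambda j = d -> (forall i, i != j -> lambda i = 0) ->
    \sum_i lambda i *: z i = d *: z j.
  move=> lj l0; rewrite (bigD1 j) //= lj big1 ?addr0 // => i ij.
  by rewrite l0 // scale0r.
split=> [[lambda [[mu [d [mu01 mu1 Dd lE]]] Pl]]|[j [d [Dd Pd]]]].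
  have mu_ge0 i : 0 <= mu i by case: (mu01 i) => ->.
  have [j muj] : exists j, mu j = 1.
    apply: contrapT => no1.
    suff s0 : \sum_j mu j = 0 by move: mu1; rewrite s0 => /esym/eqP; rewrite oner_eq0.
    by apply: big1 => i _; case: (mu01 i) => // mi; case: no1; exists i.
  have mu0 i : i != j -> mu i = 0.
    move=> ij; have : \sum_(k | k != j) mu k = 0.
      by move: mu1; rewrite (bigD1 j) //= muj -[RHS]addr0 => /addrI.
    by move/eqP; rewrite psumr_eq0 // => /allP/(_ i); rewrite mem_index_enum ij => /(_ isT)/eqP.
  exists j, d; split=> //.
  have lj : lambda j = d by rewrite lE muj mulr1.
  have l0 i : i != j -> lambda i = 0 by move=> ij; rewrite lE mu0 // mulr0.
  by move: Pl; rewrite !(sumE _ _ _ j d).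
pose mu i : R := (i == j)%:R.
have mu0 i : i != j -> d * mu i = 0 by rewrite /mu => /negPf ->; rewrite mulr0.
have muj : d * mu j = d by rewrite /mu eqxx mulr1.
exists (fun i => d * mu i); split; last by rewrite !(sumE _ _ _ j d).
exists mu, d; split=> // [i|].
  by rewrite /mu; case: (i == j); [right|left].
by rewrite (bigD1 j) //= /mu eqxx big1 ?addr0 // => i /negPf ->.
Qed.

(** * The ratios as coordinates *)

Lemma alpha_ratio_le (R : realType) (n m : nat) (x : 'I_n -> 'cV[R]_m.+1)
    (o j : 'I_n) (a : R) (x_gt0 : forall i, 0 < x o i 0) :
  alpha_ratio x o j <= a <-> forall i, x j i 0 <= a * x o i 0.
Proof.
rewrite /alpha_ratio /max_ord; case: arg_maxP => //= i0 _ max_i0.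
split=> [le_a i|le_a]; last by rewrite ler_pdivrMr.
by rewrite -ler_pdivrMr // (le_trans (max_i0 i isT)).
Qed.

Lemma beta_ratio_ge (R : realType) (n s : nat) (y : 'I_n -> 'cV[R]_s.+1)
    (o j : 'I_n) (b : R) (y_gt0 : forall r, 0 < y o r 0) :
  b <= beta_ratio y o j <-> forall r, b * y o r 0 <= y j r 0.
Proof.
rewrite /beta_ratio /min_ord; case: arg_minP => //= r0 _ min_r0.
split=> [ge_b r|ge_b]; last by rewrite ler_pdivlMr.
by rewrite -ler_pdivlMr // (le_trans ge_b) // min_r0.
Qed.

Lemma alpha_ratio_gt0 (R : realType) (n m : nat) (x : 'I_n -> 'cV[R]_m.+1)
    (o j : 'I_n) (x_gt0 : forall j i, 0 < x j i 0) :
  0 < alpha_ratio x o j.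
Proof. by rewrite /alpha_ratio /max_ord divr_gt0. Qed.

Lemma beta_ratio_gt0 (R : realType) (n s : nat) (y : 'I_n -> 'cV[R]_s.+1)
    (o j : 'I_n) (y_gt0 : forall j r, 0 < y j r 0) :
  0 < beta_ratio y o j.
Proof. by rewrite /beta_ratio /min_ord divr_gt0. Qed.

Lemma alpha_ratio_self (R : realType) (n m : nat) (x : 'I_n -> 'cV[R]_m.+1)
    (o : 'I_n) (x_gt0 : forall j i, 0 < x j i 0) :
  alpha_ratio x o o = 1.
Proof. by rewrite /alpha_ratio /max_ord divff // gt_eqF. Qed.

Lemma beta_ratio_self (R : realType) (n s : nat) (y : 'I_n -> 'cV[R]_s.+1)
    (o : 'I_n) (y_gt0 : forall j r, 0 < y j r 0) :
  beta_ratio y o o = 1.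
Proof. by rewrite /beta_ratio /min_ord divff // gt_eqF. Qed.

Section Technology.

Context (R : realType) (n m s : nat).
Context (x : 'I_n -> 'cV[R]_m.+1) (y : 'I_n -> 'cV[R]_s.+1) (o : 'I_n).
Hypothesis x_gt0 : forall j i, 0 < x j i 0.
Hypothesis y_gt0 : forall j r, 0 < y j r 0.

Local Notation a_ := (alpha_ratio x o).
Local Notation b_ := (beta_ratio y o).

(** Comparing with the ratios requires dividing by [d].  A zero scaling satisfies
    neither side, because it produces no output while [y o] is positive. *)
Lemma radial_feasibleP (Delta : set R) (t : R) :
  (forall d, Delta d -> 0 <= d) ->
  (exists lambda : 'I_n -> R,
    [/\ intensity Delta lambda,
        levec (\sum_j lambda j *: x j) (t *: x o)
      & levec (y o) (\sum_j lambda j *: y j)]) <->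
  (exists j d, [/\ Delta d, d * a_ j <= t & 1 <= d * b_ j]).
Proof.
move=> D_ge0.
have scaled_le d j : 0 < d -> levec (d *: x j) (t *: x o) <-> d * a_ j <= t.
  move=> d0; rewrite mulrC -ler_pdivlMr // alpha_ratio_le //.
  by split=> H i; move: (H i); rewrite !mxE mulrAC ler_pdivlMr // mulrC.
have scaled_ge d j : 0 < d -> levec (y o) (d *: y j) <-> 1 <= d * b_ j.
  move=> d0; rewrite mulrC -ler_pdivrMr // beta_ratio_ge //.
  by split=> H r; move: (H r); rewrite !mxE mulrAC mul1r ler_pdivrMr // mulrC.
split=> [[lambda [Il lex gey]]|[j [d [Dd le_t ge1]]]].
  have [|j [d [Dd [lex' gey']]]] := (intensityP x y Delta
      (fun u v => levec u (t *: x o) /\ levec (y o) v)).1.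
    by exists lambda.
  have d0 : 0 < d.
    rewrite lt_neqAle (D_ge0 _ Dd) andbT; apply/eqP => d0.
    by move: (gey' ord0); rewrite -d0 scale0r mxE leNgt y_gt0.
  by exists j, d; split=> //; [apply/scaled_le|apply/scaled_ge].
have d0 : 0 < d.
  rewrite lt_neqAle (D_ge0 _ Dd) andbT; apply/eqP => d0.
  by move: ge1; rewrite -d0 mul0r ler10.
have [|lambda [Il [lex gey]]] := (intensityP x y Delta
    (fun u v => levec u (t *: x o) /\ levec (y o) v)).2.
  by exists j, d; split=> //; split; [apply/scaled_le|apply/scaled_ge].
by exists lambda.
Qed.

Lemma FDH_V_techP (p : 'cV[R]_m.+1 * 'cV[R]_s.+1) :
  FDH_tech x y (@Delta_V R) p <->
  exists j, [/\ levec (x j) p.1, levec p.2 (y j) & levec 0 p.2].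
Proof.
have single := intensityP x y (@Delta_V R)
  (fun u v => [/\ levec u p.1, levec p.2 v & levec 0 p.2]).
split=> [[lambda [Il lex gey ge0]]|[j H]].
  have [|j [d [-> H]]] := single.1; first by exists lambda.
  by exists j; rewrite !scale1r in H.
have [|lambda [Il [? ? ?]]] := single.2.
  by exists j, 1; rewrite !scale1r.
by exists lambda.
Qed.

Lemma response_domainP (a b : R) :
  FDH_tech x y (@Delta_V R) (a *: x o, b *: y o) <->
  exists j, [/\ a_ j <= a, 0 <= b & b <= b_ j].
Proof.
split=> [/FDH_V_techP[j /= [lex gey ge0]]|[j [lea b0 leb]]].
  exists j; split.
  - by apply/alpha_ratio_le => // i; move: (lex i); rewrite mxE.
  - by move: (ge0 ord0); rewrite !mxE pmulr_lge0.
  - by apply/beta_ratio_ge => // r; move: (gey r); rewrite mxE.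
apply/FDH_V_techP; exists j; split=> k /=; rewrite !mxE.
- exact: (alpha_ratio_le _ _ (x_gt0 o)).1.
- exact: (beta_ratio_ge _ _ (y_gt0 o)).1.
- by rewrite mulr_ge0 // ltW.
Qed.

Lemma efficient_beta_le1 (j : 'I_n) :
  FDH_V_efficient x y o -> a_ j <= 1 -> b_ j <= 1.
Proof.
move=> eff aj; rewrite leNgt; apply/negP => bj; apply: eff.
exists (x j, y j); split=> /=.
- by apply/FDH_V_techP; exists j; split=> // i /=; rewrite ?mxE ?ltW.
- move=> i; move/(alpha_ratio_le _ _ (x_gt0 o)): aj => /(_ i).
  by rewrite mul1r.
- move=> r; move/ltW/(beta_ratio_ge _ _ (y_gt0 o)): bj => /(_ r).
  by rewrite mul1r.
- case=> _ yjo; move: bj.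
  have -> : b_ j = b_ o by rewrite /beta_ratio yjo.
  by rewrite beta_ratio_self // ltxx.
Qed.

(** * The response function *)

Lemma response_attained (a b : R) :
  is_response x y o a b ->
  (exists j, a_ j <= a /\ b = b_ j) /\ (forall k, a_ k <= a -> b_ k <= b).
Proof.
case=> /response_domainP[j [aj b0 bj]] ub.
have dominates k : a_ k <= a -> b_ k <= b.
  by move=> ak; apply: ub; apply/response_domainP; exists k; split=> //; apply/ltW/beta_ratio_gt0.
split=> //; exists j; split=> //; apply/eqP.
by rewrite eq_le bj dominates.
Qed.

Lemma response_exists (j : 'I_n) (a : R) :
  a_ j <= a -> exists b, is_response x y o a b.
Proof.
move=> aj.
case: (arg_maxP b_ (aj : [pred i | a_ i <= a] j)) => k ak maxk.
exists (b_ k); split.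
  by apply/response_domainP; exists k; split=> //; apply/ltW/beta_ratio_gt0.
by move=> b /response_domainP[i [ai _ /le_trans]]; apply; apply: maxk.
Qed.

(** * Increasing returns and the incremental ratio *)

(** A unit attaining the NI efficiency must be scaled down strictly, so its
    outputs exceed those of [o] by a common factor above 1; were its inputs no
    larger than those of [o], it would dominate [o]. *)
Lemma GIRS_witness :
  FDH_V_efficient x y o -> G_IRS x y o -> exists j, 1 < a_ j /\ 1 < b_ j.
Proof.
move=> eff [tND [tC [t [[_ ND_min] _ [NI_feas _] t_lt tE]]]].
rewrite {}tE in t_lt.
have [|j [d [/andP[_ d1] dat dbt]]] := (radial_feasibleP _ _).1 NI_feas.
  by move=> d /andP[].
(* The scaling 1 is common to NI and ND, so it would make [t] feasible for ND. *)
have d_lt1 : d < 1.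
  rewrite lt_neqAle d1 andbT; apply/eqP => dE; move: t_lt; rewrite ltNge => /negP; apply.
  apply: ND_min; apply/radial_feasibleP.
    by move=> e; apply: le_trans.
  by exists j, d; split=> //; rewrite dE /Delta_ND /= lexx.
have bj : 1 < b_ j.
  by rewrite (le_lt_trans dbt) // gtr_pMl // beta_ratio_gt0.
exists j; split=> //; rewrite ltNge; apply/negP => aj.
by have := efficient_beta_le1 eff aj; rewrite leNgt bj.
Qed.

End Technology.

Theorem theorem1 (R : realType) (n m s : nat)
    (x : 'I_n -> 'cV[R]_m.+1) (y : 'I_n -> 'cV[R]_s.+1) (o : 'I_n)
    (x_gt0 : forall j i, 0 < x j i 0)
    (y_gt0 : forall j r, 0 < y j r 0)
    (o_eff : FDH_V_efficient x y o)
    (o_GIRS : G_IRS x y o) :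
  Pi_set x o <> set0 /\
  exists sigma : R,
    is_max_incremental_ratio x y o sigma /\
    is_max [set (beta_ratio y o j - 1) / (alpha_ratio x o j - 1) | j in Pi_set x o]
      sigma.
Proof.
have [j0 [aj0 bj0]] := GIRS_witness x_gt0 y_gt0 o_eff o_GIRS.
split; first by move=> Pi0; have : Pi_set x o j0 := aj0; rewrite Pi0.
set a_ := alpha_ratio x o in aj0 *; set b_ := beta_ratio y o in bj0 *.
pose slope j := (b_ j - 1) / (a_ j - 1).
case: (arg_maxP slope (aj0 : [pred i | 1 < a_ i] j0)) => j /= aj maxj.
have slope_ge0 : 0 <= slope j.
  by apply: le_trans (maxj j0 aj0); rewrite divr_ge0 // subr_ge0 ltW.
have ratio_le a b : 1 < a -> is_response x y o a b ->
    (b - 1) / (a - 1) <= slope j.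
  move=> a1 /(response_attained x_gt0 y_gt0)[[k [ak ->]] ub].
  have [ak1|ak1] := leP (a_ k) 1.
    (* Efficiency makes the ratio nonpositive when [k] uses no more input. *)
    apply: le_trans slope_ge0; rewrite pmulr_lle0 ?invr_gt0 ?subr_gt0 //.
    by rewrite subr_le0 (efficient_beta_le1 x_gt0 y_gt0).
  (* The numerator must be nonnegative for a smaller denominator to help. *)
  have bk : 1 <= beta_ratio y o k.
    have := ub o; rewrite alpha_ratio_self // beta_ratio_self //.
    by move=> ubo; rewrite (le_trans (ubo (ltW a1))).
  apply: le_trans (maxj k ak1).
  by rewrite ler_wpM2l ?subr_ge0 // lef_pV2 ?posrE ?subr_gt0 // lerB.
exists (slope j); split; split.
- have [b resp] := response_exists x_gt0 y_gt0 (lexx (a_ j)).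
  exists (a_ j), b; split=> //; apply/eqP; rewrite eq_le ratio_le // andbT.
  have [_ /(_ j (lexx _)) bj] :=
    response_attained x_gt0 y_gt0 resp.
  by rewrite ler_pM2r ?invr_gt0 ?subr_gt0 // lerB.
- by move=> _ [a [b [a1 resp ->]]]; apply: ratio_le.
- by exists j.
- by move=> _ [k ak <-]; apply: maxj.
Qed.
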